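(* There exist an absolute constant $\kappa>0$ and an infinite sequence of concept classes $\mathcal C_k\subseteq\{0,1\}^{N_k}$ ($k=1,2,3,\dots$) such that $\mathsf Q(\mathcal C_k)\to\infty$ as $k\to\infty$ and, for every $k$, $$\mathsf D(\mathcal C_k)\;\ge\;\kappa\,\mathsf Q(\mathcal C_k)^3\log N_k .$$
   Context: A concept class is a set $\mathcal C\subseteq\{0,1\}^N$; its elements (concepts) are viewed as functions $c:[N]\to\{0,1\}$, and $[N]$ may be identified with any finite set of size $N$. Exact learning with membership queries: an unknown target $c^*\in\mathcal C$ is accessed by queries, and the learner must output $c^*$. A classical query at $i\in[N]$ returns $c^*_i$; queries may be adaptive. $\mathsf D(\mathcal C)$ is the minimum worst-case number of queries of a deterministic learner that always identifies $c^*$ for every $c^*\in\mathcal C$. $\mathsf Q(\mathcal C)$ is the bounded-error quantum query complexity: the minimum number of applications of the unitary $|i,b\rangle\mapsto|i,b\oplus c^*_i\rangle$ (interleaved with arbitrary target-independent unitaries, followed by a measurement) needed by a quantum algorithm that outputs $c^*$ with probability at least $2/3$ for every $c^*\in\mathcal C$. Logarithms are base 2. *)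

(* Defs.v *)
From HB Require Import structures.
From mathcomp Require Import all_boot all_order all_algebra.
From mathcomp Require Import spectral complex.
From mathcomp Require Import all_classical all_reals all_analysis.

Set Implicit Arguments.
Unset Strict Implicit.
Unset Printing Implicit Defensive.

Import Order.TTheory GRing.Theory Num.Theory.
Local Open Scope ring_scope.

Notation concept N := {ffun 'I_N -> bool}.

(* The minimum of a set of naturals.  The value 0 for the empty set is a
   convention that is not used below: see [detQ_min] and [quantumQ_min]. *)
Definition least (P : nat -> Prop) : nat :=
  xget 0%N [set n | P n /\ forall m, P m -> (n <= m)%N]%classic.

Lemma leastP (P : nat -> Prop) : (exists n, P n) ->
  P (least P) /\ forall m, P m -> (least P <= m)%N.
Proof.
move=> exP.
have exb : exists n, `[< P n >] by case: exP => n Pn; exists n; apply/asboolP.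
rewrite /least; case: xgetP => [m -> [Pm mle] //|none].
case: (ex_minnP exb) => n /asboolP Pn nmin.
by case: (none n); split=> // m Pm; apply: nmin; apply/asboolP.
Qed.

(* ** Deterministic learners *)

Inductive learner (N : nat) : Type :=
| Answer of concept N
| Query of 'I_N & learner N & learner N.

Fixpoint answer N (t : learner N) (c : concept N) : concept N :=
  match t with
  | Answer d => d
  | Query i t0 t1 => answer (if c i then t1 else t0) c
  end.

Fixpoint queries N (t : learner N) (c : concept N) : nat :=
  match t with
  | Answer _ => 0
  | Query i t0 t1 => (queries (if c i then t1 else t0) c).+1
  end.

Definition det_learnable N (C : {set concept N}) (q : nat) : Prop :=
  exists t : learner N,
    forall c, c \in C -> answer t c = c /\ (queries t c <= q)%N.

Definition detQ N (C : {set concept N}) : nat := least (det_learnable C).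

(* ** Quantum learners *)

Section Quantum.
Variables (R : realType) (N : nat).

(* The computational basis |i, b, w>, where w ranges over the basis W of an
   arbitrary finite-dimensional workspace. *)
Definition qbasis (W : finType) : finType := ('I_N * bool * W)%type.

Definition qop (W : finType) := 'M[R[i]]_#|qbasis W|.
Definition qvec (W : finType) := 'cV[R[i]]_#|qbasis W|.

Definition ket (W : finType) (x : qbasis W) : qvec W :=
  delta_mx (enum_rank x) 0.

(* The operator |x> |-> |f x>. *)
Definition basis_op (W : finType) (f : qbasis W -> qbasis W) : qop W :=
  \matrix_(r, s) (enum_val r == f (enum_val s))%:R.

Definition xor_answer (W : finType) (c : concept N) (x : qbasis W) : qbasis W :=
  let: (i, b, w) := x in (i, b (+) c i, w).

Definition query_op (W : finType) (c : concept N) : qop W :=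
  basis_op (xor_answer c).

(* The number of queries is a separate argument of [qstate]: a run with q
   queries uses only qgate 0, ..., qgate q.  The final measurement is in the
   computational basis, with outcomes labelled by concepts; any other final
   measurement is absorbed in the workspace and the last gate. *)
Record qlearner := QLearner {
  qwork : finType;
  qstart : qbasis qwork;
  qgate : nat -> qop qwork;
  qgate_unitary : forall j, qgate j \is unitarymx;
  qlabel : qbasis qwork -> concept N
}.

Fixpoint qstate (A : qlearner) (c : concept N) (q : nat) : qvec (qwork A) :=
  match q with
  | 0 => qgate A 0 *m ket (qstart A)
  | q'.+1 => qgate A q'.+1 *m (query_op (qwork A) c *m qstate A c q')
  end.

Definition qprob (A : qlearner) (q : nat) (c d : concept N) : R[i] :=
  \sum_(x | qlabel (q := A) x == d) `|qstate A c q (enum_rank x) 0| ^+ 2.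

Definition quantum_learnable (C : {set concept N}) (q : nat) : Prop :=
  exists A : qlearner, forall c, c \in C -> 2 / 3 <= qprob A q c c.

Definition quantumQ (C : {set concept N}) : nat := least (quantum_learnable C).

End Quantum.

Definition log2 (R : realType) (x : R) : R := ln x / ln 2.

(* ** Both minima are attained *)

Lemma det_learnable_ex N (C : {set concept N}) : exists q, det_learnable C q.
Proof.
suff [t tP] : exists t : learner N,
    forall c, answer t c = c /\ (queries t c <= N)%N.
  by exists N, t => c _; apply: tP.
suff /(_ N (leqnn N) [ffun=> false]) [t tP] : forall k, (k <= N)%N ->
    forall d : concept N, exists t : learner N, forall c : concept N,
    (forall i : 'I_N, (k <= i)%N -> c i = d i) ->
    answer t c = c /\ (queries t c <= k)%N.
  by exists t => c; apply: tP => i; rewrite leqNgt ltn_ord.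
elim=> [|k IH] kN d.
  by exists (Answer d) => c cd; split=> //=; apply/ffunP => i; rewrite cd.
pose upd b := [ffun i : 'I_N => if i == k :> nat then b else d i].
have [t0 t0P] := IH (ltnW kN) (upd false).
have [t1 t1P] := IH (ltnW kN) (upd true).
exists (Query (Ordinal kN) t0 t1) => c cd /=.
case: ifP => ck; [apply: t1P|apply: t0P] => i ki; rewrite ffunE;
  case: eqP => [ik|/eqP ik].
- by rewrite -ck; congr (c _); apply: val_inj.
- by apply: cd; rewrite ltn_neqAle eq_sym ik.
- by rewrite -ck; congr (c _); apply: val_inj.
- by apply: cd; rewrite ltn_neqAle eq_sym ik.
Qed.

Lemma detQ_min N (C : {set concept N}) :
  det_learnable C (detQ C) /\
  forall q, det_learnable C q -> (detQ C <= q)%N.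
Proof. exact: leastP (det_learnable_ex C). Qed.

Section QuantumMin.
Variables (R : realType) (N : nat) (W : finType).
Implicit Types (f g : qbasis N W -> qbasis N W).

Lemma basis_op_ket f (x : qbasis N W) :
  basis_op R f *m ket R x = ket R (f x).
Proof.
apply/colP => r; rewrite !mxE (bigD1 (enum_rank x)) //= big1 => [|s sx].
  rewrite !mxE !eqxx enum_rankK mulr1 addr0 andbT.
  by rewrite -[r in RHS]enum_valK (inj_eq enum_rank_inj).
by rewrite !mxE (negbTE sx) mulr0.
Qed.

Lemma basis_op_unitary f g : cancel f g -> cancel g f ->
  basis_op R f \is unitarymx.
Proof.
move=> fK gK; apply/unitarymxP/matrixP => r s; rewrite !mxE.
rewrite (bigD1 (enum_rank (g (enum_val r)))) //= big1 => [|t tr].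
  rewrite !mxE enum_rankK gK eqxx mul1r addr0 (inj_eq enum_val_inj).
  by rewrite conjC_nat eq_sym.
rewrite !mxE [_ == f _](_ : _ = false) ?mul0r //.
apply: contraNF tr => /eqP ->; rewrite fK enum_valK; exact: eqxx.
Qed.

End QuantumMin.

Section ReadAll.
Variables (R : realType) (n : nat).
Let N := n.+1.
Let B := qbasis N (concept N).

Let set_bit (w : concept N) (i : 'I_N) (b : bool) : concept N :=
  [ffun j => if j == i then b else w j].

Let store (x : B) : B :=
  let: (i, b, w) := x in (ordS i, w i, set_bit w i b).

Let unstore (x : B) : B :=
  let: (i, b, w) := x in
  (ord_pred i, w (ord_pred i), set_bit w (ord_pred i) b).

Let storeK : cancel store unstore.
Proof.
case=> -[i b] w /=; rewrite ordSK ffunE eqxx; congr (_, _).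
by apply/ffunP => j; rewrite !ffunE; case: eqP => [->|].
Qed.

Let unstoreK : cancel unstore store.
Proof.
case=> -[i b] w /=; rewrite ord_predK ffunE eqxx; congr (_, _).
by apply/ffunP => j; rewrite !ffunE; case: eqP => [->|].
Qed.

Let read_all : qlearner R N.
Proof.
apply: (@QLearner R N (concept N) (ord0, false, [ffun=> false])
  (fun j => if j is _.+1 then basis_op R store else basis_op R id) _
  (fun x => x.2)).
by case=> [|j]; [apply: (@basis_op_unitary _ _ _ id id)
                |apply: basis_op_unitary storeK unstoreK].
Defined.

Let read_allE (c : concept N) q : (q <= N)%N ->
  qstate read_all c q = ket R ((inord (q %% N), false,
    [ffun i : 'I_N => (i < q)%N && c i]) : B).
Proof.
elim: q => [_|q IH qN].
  rewrite [LHS]basis_op_ket; congr (ket R (_, _, _)).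
    by apply: val_inj; rewrite /= inordK.
have -> : qstate read_all c q.+1 =
  basis_op R store *m (basis_op R (xor_answer c) *m qstate read_all c q) by [].
rewrite IH ?(ltnW qN) // !basis_op_ket /= ffunE modn_small // inordK //.
rewrite ltnn /=; congr (ket R (_, _, _)).
  by apply: val_inj; rewrite /= !inordK ?ltn_pmod.
apply/ffunP => i; rewrite !ffunE -val_eqE /= inordK // ltnS.
rewrite [(i <= q)%N]leq_eqVlt; case: eqP => //= iq.
suff -> : inord q = i :> 'I_N by [].
by apply: val_inj; rewrite /= inordK.
Qed.

Lemma quantum_learnable_ex_succ (C : {set concept N}) :
  exists q, quantum_learnable R C q.
Proof.
exists N, read_all => c _.
rewrite /qprob read_allE // (_ : [ffun i : 'I_N => _] = c); last first.
  by apply/ffunP => i; rewrite ffunE ltn_ord.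
set x := (inord _, false, c).
rewrite (bigD1 (x : B)) //= mxE !eqxx normr1 expr1n.
apply: (@le_trans _ _ 1); first by rewrite ler_pdivrMr ?mul1r ?ler_nat.
by rewrite lerDl; apply: sumr_ge0 => y _; rewrite exprn_ge0.
Qed.

End ReadAll.

Lemma quantumQ_min (R : realType) N (C : {set concept N}) : (0 < N)%N ->
  quantum_learnable R C (quantumQ R C) /\
  forall q, quantum_learnable R C q -> (quantumQ R C <= q)%N.
Proof.
case: N C => // n C _; exact: leastP (quantum_learnable_ex_succ R C).
Qed.

(* Main.v *)
(* A concept is indexed by a tuple a of m+1 words of n bits and lives on triples
   (x, j, y), where it is 1 iff x lies in a hidden set S_a and the parity of
   a_j . y is even; the value at (x, 0, 0) thus tells whether x is in S_a, and
   the values at (x, j, .) reveal a_j as soon as x is in S_a.  The tuple 0 has an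
   empty S_0, hence the zero concept; all other S_a are a fraction 1/(2(m+1))^2
   of the points x.  A counting argument makes the S_a so generic that every half
   of the points contains one of them, so that a deterministic learner fed with
   zeros must probe half of the points.  A quantum learner finds a point of S_a
   by Grover search with 2(m+1) queries, then reads the m+1 words one query each
   by the Bernstein-Vazirani algorithm, all coherently in x.
   That the quantum complexity is unbounded follows from a rank bound: after q
   queries the state is a combination of (N+1)^q fixed vectors with coefficients
   depending on the concept, so the matrix of output probabilities, which is
   diagonally dominant, has rank at most (N+1)^(2q). *)
Require Import Defs.
From mathcomp Require Import all_boot all_order all_algebra.
From mathcomp Require Import all_classical all_reals all_analysis.
From mathcomp Require Import spectral complex.
From mathcomp Require Import zify ring lra.
Import Order.TTheory GRing.Theory Num.Theory numFieldNormedType.Exports.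

Set Implicit Arguments.
Unset Strict Implicit.
Unset Printing Implicit Defensive.

(** * A family of small sets hitting every half *)

(** In the quotient of the two falling factorials, each factor [(N - k) / (y - k)] with
    [k < s <= N / 4] is at most 4. *)
Lemma leq_bin_half (N y s : nat) : N <= y.*2 -> 4 * s <= N ->
  'C(N, s) <= 'C(y, s) * 4 ^ s.
Proof.
move=> Ny sN.
suff ff k : k <= s -> N ^_ k <= y ^_ k * 4 ^ k.
  rewrite -(leq_pmul2r (fact_gt0 s)) bin_ffact mulnAC bin_ffact.
  exact: ff.
elim: k => [|k IH] ks; first by rewrite !ffactn0.
rewrite !ffactnSr expnS; apply: leq_trans (leq_mul (IH (ltnW ks)) (leqnn _)) _.
have {}ks : N - k <= 4 * (y - k) by lia.
by apply: leq_trans (leq_mul (leqnn _) ks) _; nia.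
Qed.

(** This is [(1 + 1/n)^(n+1) >= 2]; [ber] is Bernoulli's inequality with denominators cleared. *)
Lemma double_expn_pred n : 2 * n ^ n.+1 <= n.+1 ^ n.+1.
Proof.
suff ber k : n ^ k * (n + k) <= n.+1 ^ k * n.
  case: n ber => [|n] ber; first by rewrite exp0n.
  by have := ber n.+2; rewrite (expnS _ n.+1); nia.
elim: k => [|k IH]; first by rewrite !expn0 addn0.
rewrite !expnS; nia.
Qed.

(** Each block of [n.+1] factors [n / n.+1] at least halves the product. One block more than [l]
    makes the inequality strict. *)
Lemma expn_pred_lt n l K : 0 < n -> n.+1 * l.+1 <= K ->
  2 ^ l * n ^ K < n.+1 ^ K.
Proof.
move=> n_gt0 /subnKC <-; set e := K - _.
have h : 2 ^ l.+1 * n ^ (n.+1 * l.+1) <= n.+1 ^ (n.+1 * l.+1).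
  by rewrite !expnM -expnMn leq_exp2r ?double_expn_pred.
have he : n ^ e <= n.+1 ^ e by case: (e) => // e'; rewrite leq_exp2r.
have e_gt0 : 0 < n ^ e by rewrite expn_gt0 n_gt0.
have : 0 < 2 ^ l * n ^ (n.+1 * l.+1) by rewrite muln_gt0 !expn_gt0 n_gt0.
rewrite !expnD mulnA; rewrite expnS -mulnA in h.
set u := 2 ^ l * _ in h *; nia.
Qed.

(* The probabilistic method: a uniformly random s-subset lies in a given
   half-sized set with probability at least 4^-s. *)
Lemma hitting_family (T A : finType) (s : nat) :
  0 < s -> 4 * s <= #|T| -> 4 ^ s * #|T|.+1 <= #|A| ->
  exists S : A -> {set T}, (forall a, #|S a| = s) /\
    forall Y : {set T}, #|T| <= #|Y|.*2 -> exists a, S a \subset Y.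
Proof.
move=> s_gt0 sT TA.
pose D := [set B : {set T} | #|B| == s].
pose bad (Y : {set T}) := D :\: [set B : {set T} | B \subset Y & #|B| == s].
have badE (Y : {set T}) : #|T| <= #|Y|.*2 ->
    #|bad Y| * 4 ^ s <= 'C(#|T|, s) * (4 ^ s).-1.
  move=> TY; rewrite cardsD (finset.setIidPr _) ?cards_draws ?card_draws; last first.
    by apply/fintype.subsetP => B; rewrite !inE => /andP[].
  have := leq_bin_half TY sT; have : 0 < 4 ^ s by rewrite expn_gt0.
  by move: (4 ^ s) => x; nia.
pose big := [set Y : {set T} | #|T| <= #|Y|.*2].
pose on (E : {set {set T}}) := [set F : {ffun A -> {set T}} | F \in ffun_on E].
have cardon E : #|on E| = #|E| ^ #|A| by rewrite cardsE card_ffun_on.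
(* Either some family of [s]-sets is bad for no big [Y], and it is the one sought, or the bad
   families cover all families, which the union bound over at most [2 ^ #|T|] sets [Y] refutes. *)
case: (boolP (on D \subset \bigcup_(Y in big) on (bad Y))) => [sub|]; last first.
  case/fintype.subsetPn => F; rewrite inE => /ffun_onP FD FP.
  have FDE a : #|F a| = s by have := FD a; rewrite inE => /eqP.
  exists F; split=> // Y TY; have Yb : Y \in big by rewrite inE.
  case: (pickP (fun a => F a \subset Y)) => [a|none]; first by exists a.
  case/finset.bigcupP: FP; exists Y => //; rewrite inE; apply/ffun_onP => a.
  by rewrite !inE none FDE eqxx.
have : #|on D| * (4 ^ s) ^ #|A| <= 2 ^ #|T| * ('C(#|T|, s) * (4 ^ s).-1) ^ #|A|.
  apply: leq_trans (leq_mul (subset_leq_card sub) (leqnn _)) _.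
  have : #|\bigcup_(Y in big) on (bad Y)| <= \sum_(Y in big) #|on (bad Y)|.
    elim/big_rec2: _ => [|Y m B _ mB]; first by rewrite cards0.
    by apply: leq_trans (leq_card_setU _ _).1 _; rewrite leq_add2l.
  move/leq_mul => /(_ _ _ (leqnn _))/leq_trans; apply.
  rewrite big_distrl /=.
  apply: (@leq_trans (\sum_(Y in big) ('C(#|T|, s) * (4 ^ s).-1) ^ #|A|)).
    apply: leq_sum => Y; rewrite inE => /badE h.
    by rewrite cardon -expnMn; case: #|A| => // k; rewrite leq_exp2r.
  rewrite sum_nat_const leq_mul // -cardsT -card_powerset.
  by apply/subset_leq_card/fintype.subsetP => Y _; rewrite powersetE finset.subsetT.
rewrite cardon card_draws !expnMn mulnCA leq_pmul2l; last first.
  by rewrite expn_gt0 bin_gt0; lia.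
have four : 4 ^ s = (4 ^ s).-1.+1 by rewrite prednK // expn_gt0.
rewrite leqNgt {2}four expn_pred_lt // -?four //.
case: s s_gt0 {sT TA D bad badE big sub four} => // s _.
by rewrite expnS; have := expn_gt0 4 s; lia.
Qed.

Local Open Scope classical_set_scope.
Local Open Scope ring_scope.

(** * Walsh-Hadamard transform and reflections *)

Section Parity.
Variable n : nat.
Implicit Types a b y : {ffun 'I_n -> bool}.

Definition dot a y : bool := \big[addb/false]_i (a i && y i).

Lemma dotC a y : dot a y = dot y a.
Proof. by apply: eq_bigr => i _; rewrite andbC. Qed.

Lemma dot0 y : dot [ffun=> false] y = false.
Proof. by rewrite /dot big1 // => i _; rewrite ffunE. Qed.

Lemma dot_inj a b : dot a =1 dot b -> a = b.
Proof.
move=> ab; apply/ffunP => i.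
have dotE c : dot c [ffun j => j == i] = c i.
  rewrite /dot (bigD1 i) //= ffunE eqxx andbT big1 ?addbF // => j ji.
  by rewrite ffunE (negbTE ji) andbF.
by rewrite -dotE ab dotE.
Qed.

(** Orthogonality of characters: the sum over [y] factors into one sum per coordinate, equal to 2 or
    0. *)
Lemma sum_sign_dot (C : comNzRingType) a b :
  \sum_y (-1) ^+ dot a y * (-1) ^+ dot b y = (2 ^ n)%:R * (a == b)%:R :> C.
Proof.
have signE c y : (-1) ^+ dot c y = \prod_i (-1) ^+ (c i && y i) :> C.
  rewrite /dot; elim/big_rec2: _ => [|i p d _ <-]; first by rewrite expr0.
  by rewrite signr_addb.
under eq_bigr do rewrite !signE -big_split /=.
rewrite -(bigA_distr_bigA (fun i (e : bool) =>
  (-1) ^+ (a i && e) * (-1) ^+ (b i && e) : C)) /=.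
have -> : (a == b) = [forall i, a i == b i].
  apply/eqP/forallP => [-> i|ab]; [exact: eqxx|by apply/ffunP => i; apply/eqP].
rewrite (eq_bigr (fun i => 2 * (a i == b i)%:R)) => [|i _]; last first.
  rewrite big_bool !andbT !andbF !expr0 mulr1.
  by case: (a i) (b i) => [] []; rewrite /= ?expr0 ?expr1; ring.
rewrite big_split /= prodr_const card_ord natrX; congr (_ * _).
case: forallP => [ab|/forallP]; first by rewrite big1 // => i _; rewrite ab.
rewrite negb_forall => /existsP[i /negbTE ab].
by rewrite (bigD1 i) //= ab mul0r.
Qed.

(** Fourier inversion for vector-valued functions. It yields both the unitarity of the Hadamard gate
    and the Bernstein-Vazirani readout. *)
Lemma sum_sign_dot_inv (C : comNzRingType) (V : lmodType C) (v : _ -> V) a :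
  \sum_y (-1) ^+ dot a y *: (\sum_b (-1) ^+ dot y b *: v b) =
  (2 ^ n)%:R *: v a.
Proof.
under eq_bigr do rewrite scaler_sumr.
rewrite exchange_big /= (bigD1 a) //= [X in _ + X]big1 => [|b ba].
  under eq_bigr do rewrite scalerA [dot _ a]dotC.
  by rewrite -scaler_suml sum_sign_dot eqxx mulr1 addr0.
under eq_bigr do rewrite scalerA [dot _ b]dotC.
by rewrite -scaler_suml sum_sign_dot eq_sym (negbTE ba) mulr0 scale0r.
Qed.
End Parity.

Section Kets.
Variables (C : numClosedFieldType) (B : finType).
Local Open Scope sesquilinear_scope.
Implicit Types (v : 'cV[C]_#|B|) (x : B).

Definition basis_vec x : 'cV[C]_#|B| := delta_mx (enum_rank x) 0.

Lemma basis_vecE x y : basis_vec x (enum_rank y) 0 = (y == x)%:R.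
Proof. by rewrite mxE eqxx andbT (inj_eq enum_rank_inj). Qed.

Lemma mulmx_basis_vec p (M : 'M[C]_(p, #|B|)) x :
  M *m basis_vec x = col (enum_rank x) M.
Proof. by rewrite colE. Qed.

Lemma eq_on_basis p (M M' : 'M[C]_(p, #|B|)) :
  (forall x, M *m basis_vec x = M' *m basis_vec x) -> M = M'.
Proof.
move=> h; apply/matrixP => i j; have := h (enum_val j).
by rewrite !mulmx_basis_vec enum_valK => /colP/(_ i); rewrite !mxE.
Qed.

Lemma unitarymx1 n : (1%:M : 'M[C]_n) \is unitarymx.
Proof. by apply/unitarymxP; rewrite trmx1 map_mx1 mulmx1. Qed.

(** For [v = 0] the quotient is 0 by convention and the matrix is the identity, so unitarity holds
    for every [v]. *)
Definition householder v : 'M[C]_#|B| :=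
  1%:M - (2 / (v^t* *m v) 0 0) *: (v *m v^t*).

Lemma householder_mul v (u : 'cV[C]_#|B|) :
  householder v *m u = u - (2 * (v^t* *m u) 0 0 / (v^t* *m v) 0 0) *: v.
Proof.
rewrite mulmxBl mul1mx -scalemxAl -mulmxA [v^t* *m u]mx11_scalar mul_mx_scalar.
by rewrite scalerA mulrAC !mxE.
Qed.

Lemma householder_unitary v : householder v \is unitarymx.
Proof.
set c := (v^t* *m v) 0 0.
have cC : Num.conj c = c.
  have : (v^t* *m v)^t* = v^t* *m v by rewrite trmx_mul map_mxM trmxCK.
  by move=> /matrixP/(_ 0 0); rewrite mxE [in X in X = _ -> _]mxE.
have hC : (householder v)^t* = householder v.
  have c2 : Num.conj (2 / c) = 2 / c by rewrite fmorph_div rmorph_nat /= cC.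
  rewrite /householder -/c linearB /= linearZ /= trmx1 map_mxB map_mx1 map_mxZ.
  by rewrite [X in X *: _]c2 trmx_mul map_mxM trmxCK.
apply/unitarymxP; rewrite hC; apply: eq_on_basis => x.
rewrite -mulmxA mul1mx [_ *m basis_vec x]householder_mul -/c.
set t := (_ *m basis_vec x) 0 0.
have vE : (v^t* *m (basis_vec x - (2 * t / c) *: v)) 0 0 = t - 2 * t / c * c.
  by rewrite mulmxBr -scalemxAr /t /c !mxE.
rewrite householder_mul -/c vE.
have [->|c0] := eqVneq c 0; first by rewrite !invr0 !mulr0 !scale0r !subr0.
rewrite -addrA -opprD -scalerDl [X in X *: v](_ : _ = 0) ?scale0r ?subr0 //.
by field.
Qed.

(** With [o] the real overlap of the two unit vectors, the squared norm of their difference is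
    [2 * (1 - o)] and its product with [basis_vec x] is [1 - o]. Hence the reflection subtracts
    exactly one copy of the difference. *)
Lemma householder_basis_vec (u : 'cV[C]_#|B|) x :
  (u^t* *m u) 0 0 = 1 -> Num.conj (u (enum_rank x) 0) = u (enum_rank x) 0 ->
  u (enum_rank x) 0 != 1 ->
  householder (basis_vec x - u) *m basis_vec x = u.
Proof.
set o := u (enum_rank x) 0 => u1 oC o1.
have bE y (v : 'cV[C]_#|B|) : ((basis_vec y)^t* *m v) 0 0 = v (enum_rank y) 0.
  rewrite mxE (bigD1 (enum_rank y)) //= big1 => [|i /negbTE iy].
    by rewrite !mxE !eqxx rmorph1 mul1r addr0.
  by rewrite !mxE iy rmorph0 mul0r.
have uE : (u^t* *m basis_vec x) 0 0 = o by rewrite mulmx_basis_vec !mxE.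
have vE (v : 'cV[C]_#|B|) : ((basis_vec x - u)^t* *m v) 0 0 =
    v (enum_rank x) 0 - (u^t* *m v) 0 0.
  by rewrite linearB /= map_mxB mulmxBl -(bE x v) !mxE.
have oE : (basis_vec x - u) (enum_rank x) 0 = 1 - o.
  by rewrite mxE [X in _ + X]mxE basis_vecE eqxx.
have iE : (u^t* *m (basis_vec x - u)) 0 0 = o - 1.
  by rewrite mulmxBr mxE [X in _ + X]mxE uE u1.
rewrite householder_mul !vE oE iE uE basis_vecE eqxx.
rewrite (_ : _ / _ = 1) ?scale1r ?opprB ?[_ + (u - _)]addrC ?subrK //.
rewrite mulr1n -mulr2n -[(1 - o) *+ 2]mulr_natl divff //.
by rewrite mulf_neq0 ?pnatr_eq0 // subr_eq0 eq_sym.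
Qed.
End Kets.

Section Hadamard.
Variables (C : numClosedFieldType) (B Z : finType) (n : nat).
Local Notation T := {ffun 'I_n -> bool}.
Variables (split : B -> Z * T) (join : Z * T -> B).
Hypotheses (splitK : cancel split join) (joinK : cancel join split).
(* The normalisation 2^(-n/2) of the transform. *)
Variable kap : C.
Hypotheses (kap_real : Num.conj kap = kap) (kap_sqr : kap ^+ 2 * (2 ^ n)%:R = 1).
Local Open Scope sesquilinear_scope.

Definition hadamard : 'M[C]_#|B| := \matrix_(r, s)
  let: (z, y) := split (enum_val r) in let: (z', y') := split (enum_val s) in
  (z == z')%:R * (kap * (-1) ^+ dot y y').

Lemma hadamard_mul z y : hadamard *m basis_vec C (join (z, y)) =
  kap *: \sum_y' (-1) ^+ dot y y' *: basis_vec C (join (z, y')).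
Proof.
rewrite mulmx_basis_vec; apply/colP => r; rewrite -[r]enum_valK.
move: (enum_val r) => x; rewrite -[x]splitK; case: (split x) => z' y'.
rewrite !mxE summxE !enum_rankK !joinK.
rewrite (bigD1 y') //= big1 => [|y'' yy].
  rewrite mxE basis_vecE (can_eq joinK) xpair_eqE eqxx andbT addr0 dotC.
  by rewrite mulrC -mulrA.
rewrite mxE basis_vecE (can_eq joinK) xpair_eqE [y' == _]eq_sym (negbTE yy).
by rewrite andbF mulr0.
Qed.

(** The matrix is self-adjoint, and Fourier inversion makes its square the identity. *)
Lemma hadamard_unitary : hadamard \is unitarymx.
Proof.
have hC : hadamard^t* = hadamard.
  apply/matrixP => r s; rewrite !mxE.
  case: (split (enum_val r)) (split (enum_val s)) => [z y] [z' y'].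
  by rewrite !rmorphM rmorph_nat rmorph_sign /= kap_real eq_sym dotC.
apply/unitarymxP; rewrite hC; apply: eq_on_basis => x.
rewrite -[x]splitK; case: (split x) => z y.
rewrite -mulmxA mul1mx hadamard_mul -scalemxAr mulmx_sumr.
under eq_bigr do rewrite -scalemxAr hadamard_mul scalerA mulrC -scalerA.
rewrite -scaler_sumr scalerA -expr2 sum_sign_dot_inv scalerA kap_sqr.
by rewrite scale1r.
Qed.
End Hadamard.

Section Minus.
Variables (R : realType) (N : nat) (W : finType).

(* |i>(|0> - |1>)|w>, on which a query acts as a sign. *)
Definition minus_ket (i : 'I_N) (w : W) : qvec R N W :=
  ket R (i, false, w) - ket R (i, true, w).

Lemma query_minus_ket (c : concept N) i w :
  query_op R W c *m minus_ket i w = (-1) ^+ c i *: minus_ket i w.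
Proof.
rewrite /query_op mulmxBr !basis_op_ket /=.
by case: (c i) => /=; rewrite /minus_ket ?scaleN1r ?opprB ?expr0 ?scale1r.
Qed.

Lemma minus_ketE i w i' b w' :
  minus_ket i w (enum_rank (i', b, w')) 0 =
  ((i' == i) && (w' == w))%:R * (-1) ^+ b.
Proof.
rewrite mxE [in X in _ + X]mxE ![ket R _ _ _]basis_vecE !xpair_eqE.
case: b; rewrite !andbT !andbF /= ?add0r ?subr0 ?mulr1 ?mulrN1 //.
Qed.
End Minus.

(** * The quantum learner *)

Section Class.
Variables (X : finType) (m n : nat).
Local Notation J := 'I_m.+1.
Local Notation T := {ffun 'I_n -> bool}.
Local Notation W := {ffun J -> T}.

Definition position : finType := (X * J * T)%type.

Definition hidden_concept (S : W -> {set X}) (a : W) : concept #|position| :=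
  [ffun i => let: (x, j, y) := enum_val i in (x \in S a) && ~~ dot (a j) y].

Lemma hidden_conceptE S a x j y :
  hidden_concept S a (enum_rank ((x, j, y) : position)) =
  (x \in S a) && ~~ dot (a j) y.
Proof. by rewrite ffunE enum_rankK. Qed.
End Class.

(** * The Bernstein-Vazirani step, coherent in the point x *)

Section Gates.
Variables (R : realType) (X : finType) (m n : nat).
Local Notation J := 'I_m.+1.
Local Notation T := {ffun 'I_n -> bool}.
Local Notation W := {ffun J -> T}.
Local Notation I := (position X m n).
Local Notation B := (qbasis #|I| W).
Local Notation Z := (X * J * bool * W)%type.
Local Notation t0 := ([ffun=> false] : T).
Local Notation w0 := ([ffun=> t0] : W).

Definition split_reg (s : B) : Z * T :=
  let: (i, b, w) := s in let: (x, j, y) := enum_val i in (x, j, b, w, y).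

Definition join_reg (s : Z * T) : B :=
  let: (x, j, b, w, y) := s in (enum_rank ((x, j, y) : I), b, w).

Lemma split_regK : cancel split_reg join_reg.
Proof.
move=> [[i b] w] /=; case E: (enum_val i) => [[x j] y] /=.
by rewrite -E enum_valK.
Qed.

Lemma join_regK : cancel join_reg split_reg.
Proof. by move=> [[[[x j] b] w] y]; rewrite /= enum_rankK. Qed.

Definition set_reg (w : W) (j : J) (y : T) : W :=
  [ffun j' => if j' == j then y else w j'].

Definition store (s : B) : B :=
  let: (x, j, b, w, y) := split_reg s in
  join_reg (x, ordS j, b, set_reg w j y, w j).

Definition unstore (s : B) : B :=
  let: (x, j, b, w, y) := split_reg s in
  join_reg (x, ord_pred j, b, set_reg w (ord_pred j) y, w (ord_pred j)).

Lemma set_regK w j y : set_reg (set_reg w j y) j (w j) = w.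
Proof. by apply/ffunP => j'; rewrite !ffunE; case: eqP => [->|]. Qed.

Lemma storeK : cancel store unstore.
Proof.
move=> s; rewrite -[s]split_regK; case: (split_reg s) => [[[[x j] b] w] y].
by rewrite /unstore /store !join_regK ordSK ffunE eqxx set_regK.
Qed.

Lemma unstoreK : cancel unstore store.
Proof.
move=> s; rewrite -[s]split_regK; case: (split_reg s) => [[[[x j] b] w] y].
by rewrite /unstore /store !join_regK ord_predK ffunE eqxx set_regK.
Qed.

Local Notation mket x j y w := (minus_ket R (enum_rank ((x, j, y) : I)) (w : W)).

Definition store_gate : qop R #|I| W := basis_op R store.

Lemma store_gate_unitary : store_gate \is unitarymx.
Proof. exact: basis_op_unitary storeK unstoreK. Qed.

Lemma store_mket x j y w :
  store_gate *m mket x j y w = mket x (ordS j) (w j) (set_reg w j y).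
Proof.
have sE b : store (enum_rank (x, j, y), b, w) =
    (enum_rank (x, ordS j, w j), b, set_reg w j y).
  by rewrite /store /= enum_rankK.
by rewrite /store_gate mulmxBr !basis_op_ket !sE.
Qed.

Variable kap : R[i].
Hypotheses (kap_real : Num.conj kap = kap) (kap_sqr : kap ^+ 2 * (2 ^ n)%:R = 1).

Definition had_gate : qop R #|I| W := hadamard split_reg kap.

Lemma had_gate_unitary : had_gate \is unitarymx.
Proof. exact: (hadamard_unitary split_regK join_regK). Qed.

Lemma had_mket x j y w : had_gate *m mket x j y w =
  kap *: \sum_y' (-1) ^+ dot y y' *: mket x j y' w.
Proof.
rewrite mulmxBr.
have h b : had_gate *m ket R (enum_rank ((x, j, y) : I), b, w) =
    kap *: \sum_y' (-1) ^+ dot y y' *: ket R (enum_rank ((x, j, y') : I), b, w).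
  exact: (hadamard_mul split_regK join_regK kap (x, j, b, w) y).
rewrite !h -scalerBr -sumrB; congr (_ *: _).
by apply: eq_bigr => y' _; rewrite scalerBr.
Qed.

Variables (S : W -> {set X}) (a : W).
Local Notation c := (hidden_concept S a).

(** The query phase is minus the character of [a j] when [x] is in [S a], and the trivial character
    otherwise. The second transform turns a character into its index. *)
Lemma bv_mket x j w :
  had_gate *m (query_op R W c *m (had_gate *m mket x j t0 w)) =
  (-1) ^+ (x \in S a) *: mket x j (if x \in S a then a j else t0) w.
Proof.
set d := if _ then _ else _; set e := (-1) ^+ (x \in S a).
have signE y : (-1) ^+ c (enum_rank ((x, j, y) : I)) = e * (-1) ^+ dot d y.
  rewrite hidden_conceptE /d /e; case: (x \in S a).
    by rewrite signrN mulN1r.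
  by rewrite dot0 expr0 mulr1.
rewrite had_mket -!scalemxAr !mulmx_sumr.
under eq_bigr => y _.
  rewrite dot0 expr0 scale1r query_minus_ket signE -scalemxAr had_mket.
  rewrite scalerA mulrAC [_ * kap]mulrC -scalerA.
  over.
rewrite -scaler_sumr sum_sign_dot_inv !scalerA.
by rewrite mulrA -expr2 mulrAC kap_sqr mul1r.
Qed.


Lemma bv_step x j w : store_gate *m (had_gate *m
    (query_op R W c *m (had_gate *m mket x j t0 w))) =
  (-1) ^+ (x \in S a) *: mket x (ordS j) (w j)
    (set_reg w j (if x \in S a then a j else t0)).
Proof. by rewrite bv_mket -scalemxAr store_mket. Qed.
End Gates.

(* The amplitudes, relative to the uniform ones, after q Grover iterations
   with marked set D. *)
Fixpoint grover_amp (R : fieldType) (X : finType) (D : {set X}) (q : nat)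
    (x : X) : R :=
  if q is q'.+1 then
    2 / #|X|%:R * (\sum_x' (-1) ^+ (x' \in D) * grover_amp R D q' x')
      - (-1) ^+ (x \in D) * grover_amp R D q' x
  else 1.

(** * Grover search followed by the readout of the words *)

Section Learner.
Variables (R : realType) (X : finType) (m n : nat).
Local Notation C := R[i].
Local Notation J := 'I_m.+1.
Local Notation T := {ffun 'I_n -> bool}.
Local Notation W := {ffun J -> T}.
Local Notation I := (position X m n).
Local Notation B := (qbasis #|I| W).
Local Notation t0 := ([ffun=> false] : T).
Local Notation w0 := ([ffun=> t0] : W).
Local Open Scope sesquilinear_scope.
Local Notation mket x j y w :=
  (minus_ket R (enum_rank ((x, j, y) : I)) (w : W)).
Local Notation mket0 x := (mket x ord0 t0 w0).

Definition sum_mket : qvec R #|I| W := \sum_x mket0 x.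

Lemma sum_mketE x b :
  sum_mket (enum_rank (enum_rank ((x, ord0, t0) : I), b, w0)) 0 = (-1) ^+ b.
Proof.
rewrite summxE (bigD1 x) //= minus_ketE !eqxx mul1r big1 ?addr0 // => x' xx.
rewrite minus_ketE (inj_eq enum_rank_inj) !xpair_eqE eq_sym (negbTE xx).
by rewrite mul0r.
Qed.

Lemma sum_mket_dot x : (sum_mket^t* *m mket0 x) 0 0 = 2.
Proof.
rewrite mulmxBr !mulmx_basis_vec mxE [X in _ + X]mxE !mxE !sum_mketE.
by rewrite !rmorph_sign expr0 expr1 opprK.
Qed.

Lemma sum_mket_norm : (sum_mket^t* *m sum_mket) 0 0 = 2 * #|X|%:R.
Proof.
rewrite {2}/sum_mket mulmx_sumr summxE.
by under eq_bigr do rewrite sum_mket_dot; rewrite sumr_const mulr_natr.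
Qed.

(** Grover's inversion about the mean, on the unnormalised uniform superposition. *)
Definition diffusion : qop R #|I| W := - householder sum_mket.

Lemma diffusion_unitary : diffusion \is unitarymx.
Proof.
apply/unitarymxP; rewrite linearN /= map_mxN mulNmx mulmxN opprK.
exact/unitarymxP/householder_unitary.
Qed.

Lemma diffusion_mul (f : X -> C) : (0 < #|X|)%N ->
  diffusion *m (\sum_x f x *: mket0 x) =
  \sum_x (2 / #|X|%:R * \sum_x' f x' - f x) *: mket0 x.
Proof.
move=> X_gt0; have X0 : #|X|%:R != 0 :> C by rewrite pnatr_eq0 -lt0n.
rewrite mulNmx householder_mul opprB sum_mket_norm.
have -> : (sum_mket^t* *m (\sum_x f x *: mket0 x)) 0 0 = 2 * \sum_x f x.
  rewrite mulmx_sumr summxE mulr_sumr; apply: eq_bigr => x _.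
  by rewrite -scalemxAr mxE sum_mket_dot mulrC.
rewrite (_ : 2 * _ / _ = 2 / #|X|%:R * \sum_x f x); last by field.
rewrite scaler_sumr -sumrB; apply: eq_bigr => x _.
by rewrite scalerBl.
Qed.

Variable x0 : X.
Variables kap g0 : R.
Hypotheses (kap_sqr : kap ^+ 2 * (2 ^ n)%:R = 1).
Hypotheses (g0_sqr : g0 ^+ 2 * (2 * #|X|%:R) = 1).
Local Notation had := (had_gate X m n (kap%:C)%C).
Local Notation "x %:C" := (real_complex _ x) (format "x %:C").

Definition start : B := (enum_rank ((x0, ord0, t0) : I), false, w0).

Definition init : qop R #|I| W :=
  householder (ket R start - g0%:C *: sum_mket).

Lemma init_start : init *m ket R start = g0%:C *: sum_mket.
Proof.
have g0C : Num.conj (g0%:C) = g0%:C by rewrite conj_Creal // complex_real.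
have uC : (g0%:C *: sum_mket)^t* = g0%:C *: sum_mket^t*.
  by apply/matrixP => i j; rewrite mxE mxE mxE rmorphM /= g0C;
    rewrite [in RHS]mxE ![in RHS]mxE.
have sE : (g0%:C *: sum_mket) (enum_rank start) 0 = g0%:C.
  by rewrite mxE sum_mketE mulr1.
apply: householder_basis_vec.
- rewrite uC -scalemxAl -scalemxAr scalerA mxE sum_mket_norm.
  rewrite -[2]/(2%:R) -natrM -(rmorph_nat (real_complex R)) -!rmorphM /= natrM.
  by rewrite -expr2 g0_sqr.
- by rewrite sE.
(* [g0 = 1] would force [2 * #|X| = 1]. *)
- rewrite sE; apply/eqP => /complexI g01; have := g0_sqr.
  rewrite g01 expr1n mul1r -natrM => /eqP.
  by rewrite pnatr_eq1; case: #|X| => // k; rewrite mulnS.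
Qed.

(* The gate before query q+1 is [pre K q *m post K q]: [post] ends and [pre]
   begins a Grover iteration for q <= K, a Bernstein-Vazirani step later on. *)
Definition pre (K q : nat) : qop R #|I| W :=
  if (K <= q < K + m.+1)%N then had else 1%:M.

Definition post (K q : nat) : qop R #|I| W :=
  if q is q'.+1 then if (q' < K)%N then diffusion
                     else store_gate R X m n *m had
  else init.

Lemma gate_unitary K q : pre K q *m post K q \is unitarymx.
Proof.
have kapC : Num.conj (kap%:C) = kap%:C by rewrite conj_Creal // complex_real.
have kap2 : (kap%:C) ^+ 2 * (2 ^ n)%:R = 1 :> C.
  by rewrite -(rmorph_nat (real_complex R)) -rmorphXn -rmorphM /= kap_sqr.
have hU := had_gate_unitary X m kapC kap2.
apply: mul_unitarymx; rewrite /pre /post.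
  by case: ifP => _; [exact: hU|exact: unitarymx1].
case: q => [|q]; first exact: householder_unitary.
case: ifP => _; first exact: diffusion_unitary.
exact: mul_unitarymx (store_gate_unitary _ _ _ _) hU.
Qed.

Variable S : W -> {set X}.

Definition grover_bv (K : nat) : qlearner R #|I| :=
  @QLearner R #|I| W start (fun q => pre K q *m post K q)
    (gate_unitary K) (fun s => hidden_concept S s.2).

Variable a : W.
Local Notation c := (hidden_concept S a).

Local Notation amp := (grover_amp R (S a)).

Lemma qstateS K q : qstate (grover_bv K) c q.+1 =
  pre K q.+1 *m (post K q.+1 *m (query_op R W c *m qstate (grover_bv K) c q)).
Proof. by rewrite [RHS]mulmxA. Qed.

(** During the search [y] is zero, so the query phase is just the membership of [x] in [S a]: the
    class itself serves as Grover oracle. *)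
Lemma qstate_grover K q : (q <= K)%N -> qstate (grover_bv K) c q =
  pre K q *m (g0%:C *: \sum_x (amp q x)%:C *: mket0 x).
Proof.
have X_gt0 : (0 < #|X|)%N by apply/card_gt0P; exists x0.
elim: q => [|q IH] qK.
  rewrite -[LHS]mulmxA [post K 0 *m _]init_start; congr (_ *m (_ *: _)).
  by apply: eq_bigr => x _; rewrite scale1r.
have preE : pre K q = 1%:M by rewrite /pre leqNgt qK.
have postE : post K q.+1 = diffusion by rewrite /post qK.
rewrite qstateS (IH (ltnW qK)) preE postE mul1mx; congr (_ *m _).
rewrite -!scalemxAr; congr (_ *: _).
rewrite mulmx_sumr; under eq_bigr do
  rewrite -scalemxAr query_minus_ket hidden_conceptE dotC dot0 andbT scalerA.
rewrite (diffusion_mul (fun x => (amp q x)%:C * _)) //.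
apply: eq_bigr => x _; congr (_ *: _).
rewrite /= rmorphB !rmorphM rmorph_sum /= fmorphV !rmorph_nat rmorph_sign.
congr (_ - _); last by rewrite mulrC.
by congr (_ * _); apply: eq_bigr => x' _; rewrite rmorphM rmorph_sign mulrC.
Qed.

Definition learned (t : nat) (x : X) : W :=
  [ffun j : J => if (j < t)%N && (x \in S a) then a j else t0].

Lemma learned0 x : learned 0 x = w0.
Proof. by apply/ffunP => j; rewrite !ffunE. Qed.

Lemma learnedS t x : (t < m.+1)%N ->
  set_reg (learned t x) (inord t) (if x \in S a then a (inord t) else t0) =
  learned t.+1 x.
Proof.
move=> tm; apply/ffunP => j; rewrite !ffunE -val_eqE /= inordK // ltnS.
rewrite [(j <= t)%N]leq_eqVlt; case: eqP => //= jt.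
suff -> : inord t = j :> J by [].
by apply: val_inj; rewrite /= inordK.
Qed.

Lemma learned_all x : x \in S a -> learned m.+1 x = a.
Proof. by move=> xS; apply/ffunP => j; rewrite ffunE ltn_ord xS. Qed.

(** The readout never moves [x], so each branch evolves by itself, gaining one sign and one word per
    step. The remainder mod [m.+1] records that [j] returns to 0 after the last step. *)
Lemma qstate_bv K t : (t <= m.+1)%N -> qstate (grover_bv K) c (K + t) =
  pre K (K + t) *m (g0%:C *: \sum_x
    (((-1) ^+ (x \in S a)) ^+ t * (amp K x)%:C) *:
      mket x (inord (t %% m.+1)) t0 (learned t x)).
Proof.
have kapC : Num.conj (kap%:C) = kap%:C by rewrite conj_Creal // complex_real.
have kap2 : (kap%:C) ^+ 2 * (2 ^ n)%:R = 1 :> C.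
  by rewrite -(rmorph_nat (real_complex R)) -rmorphXn -rmorphM /= kap_sqr.
elim: t => [|t IH] tm.
  have j0 : inord (0 %% m.+1) = ord0 :> J by apply: val_inj; rewrite /= inordK.
  rewrite addn0 (qstate_grover (leqnn K)) j0.
  by under [in RHS]eq_bigr do rewrite expr0 mul1r learned0.
have jt : inord (t %% m.+1) = inord t :> J by rewrite modn_small.
have jS : ordS (inord t) = inord (t.+1 %% m.+1) :> J.
  by apply: val_inj; rewrite /= !inordK ?ltn_pmod.
have preE : pre K (K + t) = had by rewrite /pre leq_addr ltn_add2l tm.
have postE : post K (K + t).+1 = store_gate R X m n *m had.
  by rewrite /post ltnNge leq_addr.
rewrite addnS qstateS (IH (ltnW tm)) preE postE; congr (_ *m _).
rewrite -!scalemxAr; congr (_ *: _).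
rewrite !mulmx_sumr; apply: eq_bigr => x _; rewrite -!scalemxAr -mulmxA.
rewrite jt (bv_step kap2 S a x (inord t) (learned t x)) jS learnedS // scalerA.
by rewrite exprSr mulrAC [learned t x _]ffunE inordK // ltnn.
Qed.

Local Notation jend := (inord (m.+1 %% m.+1) : J).

Lemma qstate_end K x b :
  qstate (grover_bv K) c (K + m.+1)
    (enum_rank (enum_rank ((x, jend, t0) : I), b, learned m.+1 x)) 0 =
  g0%:C * (((-1) ^+ (x \in S a)) ^+ m.+1 * (amp K x)%:C * (-1) ^+ b).
Proof.
have preE : pre K (K + m.+1) = 1%:M by rewrite /pre ltnn andbF.
rewrite (qstate_bv K (leqnn _)) preE mul1mx mxE; congr (_ * _).
rewrite summxE (bigD1 x) //= big1 => [|x' xx]; last first.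
  rewrite mxE minus_ketE (inj_eq enum_rank_inj) !xpair_eqE eq_sym (negbTE xx).
  by rewrite mul0r mulr0.
by rewrite mxE minus_ketE !eqxx mul1r addr0.
Qed.

(** Branches with different [x] end on different basis states, so the probabilities of the branches
    in [D], all labelled correctly, add up. The factor 2 counts the two values of the answer bit. *)
Lemma qprob_ge K (D : {set X}) :
  (forall x, x \in D -> hidden_concept S (learned m.+1 x) = c) ->
  (\sum_(x in D) 2 * g0 ^+ 2 * amp K x ^+ 2)%:C <=
    qprob (grover_bv K) (K + m.+1) c c.
Proof.
move=> Dc; rewrite /qprob.
pose h (p : X * bool) : B :=
  (enum_rank ((p.1, jend, t0) : I), p.2, learned m.+1 p.1).
pose F s : C := `|qstate (grover_bv K) c (K + m.+1) (enum_rank s) 0| ^+ 2.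
have h_inj : injective h by move=> [x b] [x' b'] [/enum_rank_inj[-> ->]].
have FE p : F (h p) = (g0 ^+ 2 * amp K p.1 ^+ 2)%:C.
  case: p => x b; rewrite /F qstate_end !normrM !normrX !normrN1 !expr1n.
  rewrite mulr1 mul1r exprMn.
  by rewrite !real_normK ?complex_real // rmorphM !rmorphXn.
have -> : (\sum_(x in D) 2 * g0 ^+ 2 * amp K x ^+ 2)%:C =
    \sum_(s in h @: [set p | p.1 \in D]%SET) F s.
  rewrite big_imset /=; last by move=> ? ? _ _; apply: h_inj.
  rewrite (eq_bigl (fun p => (p.1 \in D) && true)) => [|p]; last first.
    by rewrite inE andbT.
  rewrite -(pair_big (mem D) xpredT (fun x b => F (h (x, b)))) /= rmorph_sum.
  apply: eq_bigr => x _; rewrite big_bool !FE /= -(rmorphD (real_complex R)).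
  by congr (_ %:C); ring.
rewrite [leRHS]big_mkcond [leLHS]big_mkcond; apply: ler_sum => s _.
case: ifPn => [/imsetP[[x b]]|_]; last first.
  by case: ifP => // _; rewrite exprn_ge0.
by rewrite inE => /Dc /= hc ->; rewrite hc eqxx.
Qed.
End Learner.

(** * Grover amplitudes *)

Lemma sin_le (R : realType) (x : R) : 0 <= x -> sin x <= x.
Proof.
move=> x_ge0.
have cs : {within `[0, x], continuous (@sin R)}.
  exact/continuous_subspaceT/continuous_sin.
have [c _] := MVT_segment x_ge0 (fun y _ => is_derive_sin y) cs.
by rewrite sin0 !subr0 => ->; rewrite ler_piMl ?cos_le1.
Qed.

Lemma grover_angle (R : realType) (m : nat) : (0 < m)%N ->
  exists (th : R) (K : nat), [/\ sin th = (2 * m%:R)^-1, cos th != 0,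
    (K <= 2 * m)%N & 3 / 4 <= sin (th *+ K.*2.+1) ^+ 2].
Proof.
move=> m_gt0; set s : R := (2 * m%:R)^-1.
have m1 : 1 <= m%:R :> R by rewrite ler1n.
have s_gt0 : 0 < s by rewrite invr_gt0; lra.
have s_le : s <= 1 / 2 by rewrite /s mul1r lef_pV2 ?posrE; lra.
have sin_th : sin (asin s) = s by rewrite asinK // in_itv /=; lra.
set th := asin s in sin_th *.
have th_lt : th < pi / 2 by apply: asin_ltpi2; lra.
have th_gtN : - (pi / 2) < th by apply: asin_gtNpi2; lra.
have th_gt0 : 0 < th.
  have pi0 := pi_gt0 R.
  by rewrite -ltr_sin ?in_itv /= ?sin0 ?sin_th //; lra.
have s_th : s <= th by rewrite -sin_th sin_le // ltW.
have cos_th : cos th ^+ 2 = 1 - s ^+ 2 by rewrite -sin_th cos2sin2.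
have pi4 : pi <= 4 :> R by have [/andP[_ ?] _] := pihalf_02_cos_pihalf R; lra.
(* With this [K], the angle [(2K+1) * th] is within [th] of [pi / 2], so its squared sine is at
   least [cos th ^+ 2 = 1 - s ^+ 2 >= 3 / 4]. Also [K <= 1 / th <= 1 / s] because [pi <= 4]. *)
set K := Num.truncn (pi / (4 * th)).
have /truncn_itv/andP[K1 K2] : 0 <= pi / (4 * th).
  by rewrite divr_ge0 ?pi_ge0 //; lra.
rewrite -/K in K1 K2.
have th4 : 0 < 4 * th by lra.
have K1' : K%:R * (4 * th) <= pi by rewrite -ler_pdivlMr.
have K2' : pi < (K%:R + 1) * (4 * th).
  by move: K2; rewrite -[K.+1%:R]natr1 ltr_pdivrMr.
exists th, K; split=> //.
- by apply: contraTneq isT => c0; move: cos_th; rewrite c0; nra.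
- rewrite -(ler_nat R) natrM; apply: le_trans K1 _.
  rewrite ler_pdivrMr //; have : s * (2 * m%:R) = 1 by rewrite mulVf //; lra.
  nra.
set d := th *+ K.*2.+1 - pi / 2.
have dE : d = (2 * K%:R + 1) * th - pi / 2.
  have KE : K.*2.+1%:R = 2 * K%:R + 1 :> R.
    by rewrite -[LHS]natr1 -mul2n natrM.
  by rewrite /d -[th *+ _]mulr_natl KE.
have -> : th *+ K.*2.+1 = d + pi / 2 by rewrite /d subrK.
rewrite sinDpihalf -cos_norm.
have d_le : `|d| <= th by rewrite ler_norml dE; nra.
have cos_le : cos th <= cos `|d|.
  rewrite leNgt ltr_cos ?in_itv /= ?normr_ge0 -?leNgt //; last by lra.
  by have := pi_gt0 R; lra.
have cos_ge0 : 0 <= cos th by apply: cos_ge0_pihalf; lra.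
apply: (@le_trans _ _ (cos th ^+ 2)); last by nra.
by rewrite cos_th; nra.
Qed.

Section GroverAmplitude.
Variables (R : realType) (X : finType).

Lemma grover_amp0 q x : (0 < #|X|)%N -> grover_amp R (@finset.set0 X) q x = 1.
Proof.
move=> X_gt0; have X0 : #|X|%:R != 0 :> R by rewrite pnatr_eq0 -lt0n.
elim: q x => [//|q IH] x /=.
rewrite inE expr0 mul1r IH (eq_bigr (fun=> 1)) => [|x' _]; last first.
  by rewrite inE expr0 mul1r IH.
by rewrite sumr_const -[X in _ * X - _]/(#|X|%:R) divfK //; lra.
Qed.

(** When the marked fraction is [sin th ^+ 2], one iteration is a rotation by [2 * th] in the plane
    of the marked and unmarked parts. *)
Lemma grover_ampE (D : {set X}) (th : R) q x :
  #|D|%:R = sin th ^+ 2 * #|X|%:R -> (0 < #|D|)%N -> cos th != 0 ->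
  grover_amp R D q x = if x \in D then sin (th *+ q.*2.+1) / sin th
                       else cos (th *+ q.*2.+1) / cos th.
Proof.
move=> DX D_gt0 c0; set s := sin th in DX *; set k := cos th in c0 *.
have D0 : #|D|%:R != 0 :> R by rewrite pnatr_eq0 -lt0n.
have s0 : s != 0 by apply: contraNneq D0 => s0; rewrite DX s0 expr0n mul0r.
have X0 : #|X|%:R != 0 :> R by apply: contraNneq D0 => X0; rewrite DX X0 mulr0.
have sk : k ^+ 2 = 1 - s ^+ 2 by exact: cos2sin2.
elim: q x => [|q IH] x /=; first by rewrite mulr1n !divff // if_same.
set S := sin (th *+ q.*2.+1) in IH; set K := cos (th *+ q.*2.+1) in IH.
(* The mean after the sign flip is the cosine of [(2q+2) * th]. *)
have -> : \sum_x' (-1) ^+ (x' \in D) * grover_amp R D q x' =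
    #|X|%:R * (k * K - s * S).
  rewrite (bigID (mem D)) /=.
  rewrite (eq_bigr (fun=> - (S / s))) => [|y yD]; last first.
    by rewrite IH yD expr1 mulN1r.
  rewrite [X in _ + X](eq_bigr (fun=> K / k)) => [|y /negbTE yD]; last first.
    by rewrite IH yD expr0 mul1r.
  rewrite !sumr_const -(cardsE (fun y => y \notin D)).
  have -> : #|[set y | y \notin D]%SET| = #|finset.setC D|.
    by apply: eq_card => y; rewrite !inE.
  rewrite -[_ *+ #|D|]mulr_natr -[_ *+ #|finset.setC D|]mulr_natr.
  rewrite (cardsCs (finset.setC D)) finset.setCK natrB ?max_card // DX.
  rewrite (_ : _ - s ^+ 2 * _ = k ^+ 2 * #|X|%:R); last by rewrite sk; ring.
  by field; rewrite c0 s0.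
have -> : th *+ (q.+1).*2.+1 = th *+ q.*2.+1 + th + th.
  by rewrite doubleS mulrSr mulrSr.
rewrite IH !sinD !cosD !sinD -/s -/k -/S -/K.
case: (x \in D).
  have -> : (S * k + K * s) * k + (K * k - S * s) * s =
      2 * s * k * K + S - 2 * s ^+ 2 * S.
    have : S * (k ^+ 2 - (1 - s ^+ 2)) = 0 by rewrite sk subrr mulr0.
    by lra.
  by rewrite expr1; field; rewrite s0.
have -> : (K * k - S * s) * k - (S * k + K * s) * s =
    2 * k * (k * K - s * S) - K.
  have : K * (k ^+ 2 - (1 - s ^+ 2)) = 0 by rewrite sk subrr mulr0.
  by lra.
by rewrite expr0; field; rewrite c0.
Qed.
End GroverAmplitude.

(** * The rank bound *)

(** A kernel vector contradicts dominance at its coordinate of largest modulus. *)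
Lemma diag_dominant_rank (R : rcfType) n (P : 'M[R[i]]_n) :
  (forall i, \sum_(j | j != i) `|P i j| < `|P i i|) -> \rank P = n.
Proof.
move=> dom; rewrite -mxrank_tr; apply/eqP; apply: inj_row_free => u uP.
case: n P dom u uP => [|n] P dom u uP; first by apply/rowP => -[].
(* The maximum is taken over real numbers, since the order on [R[i]] is only partial. *)
pose h i : R := complex.Re `|u 0 i|.
have hE i : `|u 0 i| = real_complex R (h i) by rewrite RRe_real ?normr_real.
pose i0 := [arg max_(i > ord0) h i]%O.
have u_max j : `|u 0 j| <= `|u 0 i0|.
  by rewrite !hE lecR /i0; case: arg_maxP => // i _; apply.
suff u0 : u 0 i0 = 0.
  apply/rowP => j; rewrite mxE; apply/eqP; rewrite -normr_le0.
  by rewrite (le_trans (u_max j)) // u0 normr0.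
apply/eqP/contraT => u0; have u_gt0 : 0 < `|u 0 i0| by rewrite normr_gt0.
have : \sum_j u 0 j * P i0 j = 0.
  by have /rowP/(_ i0) := uP; rewrite !mxE => h0; rewrite -[RHS]h0;
    apply: eq_bigr => j _; rewrite mxE.
rewrite (bigD1 i0) //= => /eqP; rewrite addr_eq0 => /eqP h0.
have := dom i0; rewrite -(ltr_pM2l u_gt0) -normrM h0 normrN => /lt_geF <-.
apply: le_trans (ler_norm_sum _ _ _) _.
rewrite mulr_sumr; apply: ler_sum => j _; rewrite normrM.
exact: ler_wpM2r (u_max j).
Qed.

Section Counting.
Variables (R : realType) (N : nat).
Local Open Scope sesquilinear_scope.
Local Notation C := R[i].

(** On a ket with index [i], only the [i]-th summand acts. *)
Lemma query_op_affine (W : finType) (c : concept N) : query_op R W c = 1%:M +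
  \sum_i (c i)%:R *: (query_op R W [ffun j => j == i] - 1%:M).
Proof.
apply: eq_on_basis => -[[i b] w].
rewrite mulmxDl mul1mx mulmx_suml /query_op [LHS]basis_op_ket /=.
rewrite (bigD1 i) //= big1 => [|i' ii].
  rewrite -scalemxAl mulmxBl mul1mx [basis_op _ _ *m _]basis_op_ket /= ffunE eqxx.
  case: (c i); rewrite ?addbT ?addbF /= ?scale1r ?scale0r !addr0 //.
  by rewrite addrC subrK.
rewrite -scalemxAl mulmxBl mul1mx [basis_op _ _ *m _]basis_op_ket /= ffunE.
by rewrite eq_sym (negbTE ii) addbF subrr scaler0.
Qed.

Variable A : qlearner R N.

(** By [query_op_affine], each query replaces a vector by [N.+1] vectors that do not depend on the
    concept. *)
Lemma qstate_span q : exists (K : finType) (f : K -> concept N -> C)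
    (v : K -> qvec R N (qwork A)), #|K| = (N.+1 ^ q)%N /\
  forall c, qstate A c q = \sum_k f k c *: v k.
Proof.
elim: q => [|q [K [f [v [cardK qE]]]]].
  exists unit, (fun _ _ => 1), (fun _ => qgate A 0 *m ket R (qstart A)).
  rewrite card_unit; split=> // c; rewrite (bigD1 tt) //= big1 ?addr0 ?scale1r //.
pose O i : qop R N (qwork A) :=
  query_op R (qwork A) [ffun j => j == i] - 1%:M.
exists (K + 'I_N * K)%type,
  (fun s c => match s with inl k => f k c | inr p => (c p.1)%:R * f p.2 c end),
  (fun s => qgate A q.+1 *m
     match s with inl k => v k | inr p => O p.1 *m v p.2 end).
split=> [|c].
  by rewrite card_sum card_prod card_ord cardK -mulSn -expnS.
rewrite /= qE query_op_affine mulmxDl mul1mx mulmxDr big_sumType /=.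
congr (_ + _).
  by rewrite mulmx_sumr; apply: eq_bigr => k _; rewrite -scalemxAr.
rewrite mulmx_suml mulmx_sumr -(pair_big xpredT xpredT (fun i k =>
  ((c i)%:R * f k c) *: (qgate A q.+1 *m (O i *m v k)))) /=.
apply: eq_bigr => i _; rewrite !mulmx_sumr; apply: eq_bigr => k _.
by rewrite -scalemxAl -!scalemxAr scalerA.
Qed.

Lemma query_op_unitary (W : finType) (c : concept N) :
  query_op R W c \is unitarymx.
Proof.
have xorK : cancel (@xor_answer N W c) (xor_answer c).
  by move=> [[i b] w] /=; rewrite addbK.
exact: (@basis_op_unitary R N W _ _ xorK xorK).
Qed.

Lemma qstate_norm q c : ((qstate A c q)^t* *m qstate A c q) 0 0 = 1.
Proof.
have unit_mul (U : qop R N (qwork A)) (v : qvec R N (qwork A)) :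
    U \is unitarymx -> (U *m v)^t* *m (U *m v) = v^t* *m v.
  move=> UU; rewrite trmx_mul map_mxM mulmxA -[X in X *m v]mulmxA.
  rewrite -trmxC_unitary in UU; move/unitarymxP: UU; rewrite trmxCK => ->.
  by rewrite mulmx1.
elim: q => [|q IH] /=.
  rewrite unit_mul ?qgate_unitary // mulmx_basis_vec /ket !mxE.
  by rewrite !eqxx rmorph1.
by rewrite !unit_mul ?qgate_unitary ?query_op_unitary.
Qed.

Lemma sum_qprob q c : \sum_d qprob A q c d = 1.
Proof.
rewrite -[RHS](qstate_norm q c) mxE.
rewrite (reindex (@enum_rank _)) /=; last exact: onW_bij (enum_rank_bij _).
rewrite (partition_big (@qlabel R N A) xpredT) //=.
apply: eq_bigr => d _; apply: eq_bigr => x _.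
by rewrite 2!mxE normCKC.
Qed.

Lemma card_quantum_learnable (D : {set concept N}) q :
  (forall c, c \in D -> 2 / 3 <= qprob A q c c) -> (#|D| <= N.+1 ^ q.*2)%N.
Proof.
move=> Dq; have [K [f [v [cardK qE]]]] := qstate_span q.
(* Expanding the squared amplitudes over pairs of spanning vectors factors the probability matrix:
   [F] holds the coefficients, [G] the vectors. *)
pose F : 'M[C]_(#|D|, #|{: K * K}|) := \matrix_(i, s)
  (f (enum_val s).1 (enum_val i) * Num.conj (f (enum_val s).2 (enum_val i))).
pose G : 'M[C]_(#|{: K * K}|, #|D|) := \matrix_(s, j)
  \sum_(x | qlabel (q := A) x == enum_val j)
    v (enum_val s).1 (enum_rank x) 0 * Num.conj (v (enum_val s).2 (enum_rank x) 0).
have PE i j : (F *m G) i j = qprob A q (enum_val i) (enum_val j).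
  rewrite mxE (reindex (@enum_rank _)) /=; last exact: onW_bij (enum_rank_bij _).
  under eq_bigr do rewrite !mxE !enum_rankK mulr_sumr.
  rewrite exchange_big /=; apply: eq_bigr => x _.
  rewrite normCK qE summxE rmorph_sum /= big_distrlr /= -(pair_big xpredT xpredT
    (fun k k' => f k (enum_val i) * Num.conj (f k' (enum_val i)) *
      (v k (enum_rank x) 0 * Num.conj (v k' (enum_rank x) 0)))) /=.
  apply: eq_bigr => k _; apply: eq_bigr => k' _.
  by rewrite !mxE rmorphM mulrACA.
suff PD : \rank (F *m G) = #|D|.
  rewrite -PD (leq_trans (mulmx_max_rank F G)) // card_prod cardK -expnD.
  by rewrite addnn.
apply: diag_dominant_rank => i.
have P_ge0 d : 0 <= qprob A q (enum_val i) d.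
  by apply: sumr_ge0 => x _; rewrite exprn_ge0.
under eq_bigr do rewrite PE ger0_norm //.
rewrite PE ger0_norm //; set p := qprob _ _ _ _.
have p23 : 2 / 3 <= p by apply/Dq/enum_valP.
(* The off-diagonal row sum is at most [1 - p <= 1 / 3], below the diagonal entry. *)
have le1 : \sum_(j | j != i) qprob A q (enum_val i) (enum_val j) <= 1 - p.
  rewrite -(sum_qprob q (enum_val i)) lerBrDl (bigD1 (enum_val i)) //= -/p.
  rewrite lerD2l.
  rewrite (eq_bigl (fun j => enum_val j != enum_val i)) => [|j]; last first.
    by rewrite (inj_eq enum_val_inj).
  rewrite -(big_enum_val_cond (A := mem D) (fun d => d != enum_val i)
    (qprob A q (enum_val i))) /=.
  rewrite big_mkcond [leRHS]big_mkcond; apply: ler_sum => d _.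
  by case: (d \in D); case: ifP.
apply: le_lt_trans le1 _; rewrite ltrBlDr.
apply: lt_le_trans (lerD p23 p23).
rewrite -mulrDl ltr_pdivlMr ?ltr0n // mul1r -natrD ltr_nat //.
Qed.
End Counting.

(** * Query bounds for the hidden classes *)

Section Adversary.
Variable N : nat.
Implicit Types (t : learner N) (c d : concept N).

Fixpoint asked t c : seq 'I_N :=
  match t with
  | Answer _ => [::]
  | Query i t0 t1 => i :: asked (if c i then t1 else t0) c
  end.

Lemma size_asked t c : size (asked t c) = queries t c.
Proof. by elim: t => //= i t0 IH0 t1 IH1; case: (c i); rewrite ?IH0 ?IH1. Qed.

Lemma eq_answer t c d : {in asked t c, c =1 d} -> answer t c = answer t d.
Proof.
elim: t => //= i t0 IH0 t1 IH1 cd.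
rewrite -(cd i) ?mem_head //.
have {}cd j : j \in asked (if c i then t1 else t0) c -> c j = d j.
  by move=> jc; apply: cd; rewrite inE jc orbT.
by case: (c i) cd => cd; [apply: IH1|apply: IH0].
Qed.
End Adversary.

Section HiddenClass.
Variables (X : finType) (m n : nat).
Local Notation T := {ffun 'I_n -> bool}.
Local Notation W := {ffun 'I_m.+1 -> T}.
Local Notation w0 := ([ffun=> [ffun=> false]] : W).
Variable S : W -> {set X}.
Hypothesis S0 : S w0 = finset.set0.
Hypothesis S_neq0 : forall a, a != w0 -> S a != finset.set0.

Definition hidden_class : {set concept #|position X m n|} :=
  [set hidden_concept S a | a in finset.setT]%SET.

Lemma hidden_concept0 a : S a = finset.set0 ->
  hidden_concept S a = [ffun=> false].
Proof.
move=> Sa; apply/ffunP => i; rewrite !ffunE.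
by case: (enum_val i) => -[x j] y; rewrite Sa inE.
Qed.

(** The values at [y = 0] determine [S a]. If it is empty then [a] is [w0]; otherwise the parities
    at one of its points determine every word. *)
Lemma hidden_concept_inj : injective (hidden_concept S).
Proof.
move=> a b ab.
have abE x j y : (x \in S a) && ~~ dot (a j) y = (x \in S b) && ~~ dot (b j) y.
  by rewrite -!hidden_conceptE ab.
have memE x : (x \in S a) = (x \in S b).
  have := abE x ord0 [ffun=> false].
  by rewrite !(dotC _ [ffun=> false]) !dot0 !andbT.
have [a0|/S_neq0/set0Pn[x xa]] := eqVneq a w0.
  have [-> //|/S_neq0/set0Pn[x]] := eqVneq b w0.
  by rewrite -memE a0 S0 inE.
apply/ffunP => j; apply: dot_inj => y; apply: negb_inj.
by have := abE x j y; rewrite -memE xa.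
Qed.

Lemma card_hidden_class : #|hidden_class| = ((2 ^ n) ^ m.+1)%N.
Proof.
rewrite card_imset ?cardsT ?card_ffun ?card_bool ?card_ord //.
exact: hidden_concept_inj.
Qed.

(** If at most half of the points are probed when all answers are 0, some nonempty [S a] avoids
    them, and its concept gives the same run as the zero concept. *)
Lemma det_hidden_class q :
  (forall Y : {set X}, (#|X| <= #|Y|.*2)%N -> exists2 a, a != w0 & S a \subset Y) ->
  det_learnable hidden_class q -> (#|X| < q.*2)%N.
Proof.
move=> hit [t tP]; rewrite ltnNge; apply/negP => qX.
pose c0 : concept #|position X m n| := [ffun=> false].
have c0E : hidden_concept S w0 = c0 by exact: hidden_concept0.
have inC a : hidden_concept S a \in hidden_class by apply: imset_f; rewrite inE.
have [t0 q0] := tP _ (inC w0); rewrite c0E in t0 q0.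
pose qs := [set x | x \in [seq (enum_val i).1.1 | i <- asked t c0]]%SET.
have qs_le : (#|qs| <= q)%N.
  rewrite cardsE (leq_trans (card_size _)) // size_map size_asked //.
have [|a a0 aqs] := hit (finset.setC qs).
  by rewrite cardsCs finset.setCK; lia.
have ac : hidden_concept S a = c0.
  have [<- _] := tP _ (inC a); rewrite -t0; apply/esym/eq_answer => i iq.
  rewrite !ffunE; case E: (enum_val i) => [[x j] y].
  case: (boolP (x \in S a)) => //= /(fintype.subsetP aqs).
  rewrite !inE => /negP[]; apply/mapP; exists i => //; by rewrite E.
by case/eqP: a0; apply: hidden_concept_inj; rewrite ac c0E.
Qed.
End HiddenClass.

Lemma quantum_hidden_class (R : realType) (X : finType) (m n : nat)
    (S : {ffun 'I_m.+1 -> {ffun 'I_n -> bool}} -> {set X}) (th : R) (K : nat) :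
  (0 < #|X|)%N -> cos th != 0 ->
  3 / 4 <= sin (th *+ K.*2.+1) ^+ 2 ->
  (forall a, S a = finset.set0 \/
    [/\ (0 < #|S a|)%N & #|S a|%:R = sin th ^+ 2 * #|X|%:R]) ->
  S [ffun=> [ffun=> false]] = finset.set0 ->
  quantum_learnable R (hidden_class S) (K + m.+1).
Proof.
move=> X_gt0 c0 sinK SP S0.
have X0 : 0 < #|X|%:R :> R by rewrite ltr0n.
case/card_gt0P: (X_gt0) => x0 _.
pose kap : R := Num.sqrt (2 ^ n)%:R^-1.
pose g0 : R := Num.sqrt (2 * #|X|%:R)^-1.
have kap_sqr : kap ^+ 2 * (2 ^ n)%:R = 1.
  by rewrite sqr_sqrtr ?invr_ge0 ?ler0n // mulVf // pnatr_eq0 expn_eq0.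
have g0_sqr : g0 ^+ 2 * (2 * #|X|%:R) = 1.
  by rewrite sqr_sqrtr ?invr_ge0 ?mulVf //; lra.
exists (grover_bv x0 g0 kap_sqr S K) => c /imsetP[a _ ->].
have ex (x : R) : 2 / 3 <= x -> 2 / 3 <= (real_complex R x) :> R[i].
  move=> x23; rewrite -(rmorph_nat (real_complex R) 2).
  by rewrite -(rmorph_nat (real_complex R) 3) -fmorphV -rmorphM lecR.
(* If [S a] is empty, all branches end with the zero table, which labels the zero concept, and
   success is certain. Otherwise the branches in [S a] carry weight at least 3/4. *)
have [Sa|[S_gt0 SX]] := SP a.
  apply: le_trans (qprob_ge x0 kap_sqr g0_sqr (S := S) (a := a) K
    (D := finset.setT) _).
    apply: ex; rewrite (eq_bigr (fun=> 2 * g0 ^+ 2)) => [|x _]; last first.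
      by rewrite Sa grover_amp0 // expr1n mulr1.
    by rewrite sumr_const cardsT -[_ *+ #|X|]mulr_natr; lra.
  move=> x _; rewrite (hidden_concept0 Sa).
  suff -> : learned S a m.+1 x = [ffun=> [ffun=> false]] by apply: hidden_concept0.
  by apply/ffunP => j; rewrite !ffunE Sa inE andbF.
apply: le_trans (qprob_ge x0 kap_sqr g0_sqr (S := S) (a := a) K
  (D := S a) _) => [|x xa]; last by rewrite learned_all.
apply: ex.
rewrite (eq_bigr (fun=> 2 * g0 ^+ 2 * (sin (th *+ K.*2.+1) / sin th) ^+ 2)) =>
  [|x xa]; last by rewrite (grover_ampE _ _ SX) // xa.
rewrite sumr_const -[_ *+ #|S a|]mulr_natr SX.
have s0 : sin th != 0.
  by apply: contraTneq S_gt0 => s0; rewrite -(ltr_nat R) SX s0 expr0n mul0r ltxx.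
have -> : 2 * g0 ^+ 2 * (sin (th *+ K.*2.+1) / sin th) ^+ 2 *
    (sin th ^+ 2 * #|X|%:R) =
    g0 ^+ 2 * (2 * #|X|%:R) * sin (th *+ K.*2.+1) ^+ 2 by field.
by rewrite g0_sqr mul1r; lra.
Qed.

(** * Parameters *)

(** The size condition of [hitting_family] for [s = v], [4 * v ^ 2] points and [2 ^ (8 * v)] tuples;
    strictness leaves room to drop the zero tuple. *)
Lemma leq_expn_params (v : nat) : (0 < v)%N ->
  (4 ^ v * (4 * v ^ 2).+1 < 2 ^ (8 * v))%N.
Proof.
move=> v_gt0; have v4 : (v ^ 2 <= 4 ^ v)%N.
  by rewrite -[4%N]/(2 ^ 2)%N -expnM mulnC expnM leq_exp2r // ltnW // ltn_expl.
have -> : (2 ^ (8 * v) = (4 ^ v) ^ 4)%N.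
  by rewrite -[4%N in RHS]/(2 ^ 2)%N -!expnM; congr (_ ^ _)%N; lia.
have : (4 <= 4 ^ v)%N by rewrite -{1}[4%N]expn1 leq_exp2l.
move: (4 ^ v)%N (v ^ 2)%N v4 => x y; rewrite !expnS expn0 muln1 => yx x4.
have x2 : (16 <= x * x)%N by rewrite (leq_mul x4 x4).
have : ((4 * y).+1 < x * (x * x))%N by nia.
by nia.
Qed.

Lemma hidden_class_params (R : realType) (m : nat) :
  let mu := m.+1 in let N := (4 * mu ^ 5 * 2 ^ (8 * mu))%N in
  exists C : {set concept N}, [/\ #|C| = (2 ^ (8 * mu ^ 2))%N,
    exists2 q, (q <= 3 * mu)%N & quantum_learnable R C q &
    forall q, det_learnable C q -> (2 * mu ^ 4 <= q)%N].
Proof.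
(* Hidden sets of size [mu ^ 2] among [4 * mu ^ 4] points have density [1 / (2 * mu) ^ 2]. Words of
   [8 * mu] bits give enough tuples while the logarithm of [N] stays linear in [mu]. *)
move=> mu N; pose X : finType := 'I_(4 * mu ^ 4); pose n := (8 * mu)%N.
have cardX : #|X| = (4 * (mu ^ 2) ^ 2)%N by rewrite card_ord -expnM.
pose T : finType := {ffun 'I_n -> bool}.
pose W : finType := {ffun 'I_mu -> T}; pose w0 : W := [ffun=> [ffun=> false]].
have cardN : #|position X m n| = N.
  rewrite !card_prod card_ffun !card_ord card_bool /N; rewrite [(mu ^ 5)%N]expnSr.
  by rewrite mulnA.
have cardW : #|W| = (2 ^ (8 * mu ^ 2))%N.
  by rewrite !card_ffun !card_ord card_bool -expnM /n -mulnA mulnn.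
have mu2_gt0 : (0 < mu ^ 2)%N by rewrite expn_gt0.
have [||S' [cardS hitS]] := @hitting_family X {w : W | w != w0} (mu ^ 2) mu2_gt0.
- by rewrite cardX leq_mul // -[X in (X <= _)%N]expn1 leq_pexp2l.
- have := leq_expn_params mu2_gt0; rewrite -cardX -cardW card_sig.
  rewrite (cardD1 w0) inE /= ltnS; congr (_ <= _)%N; apply: eq_card => w.
  by rewrite !inE andbT.
pose S (w : W) : {set X} := oapp S' finset.set0 (insub w).
have S0 : S w0 = finset.set0 by rewrite /S insubN //= eqxx.
have SE w : w != w0 -> #|S w| = (mu ^ 2)%N by move=> ww; rewrite /S insubT /= cardS.
have Sn0 w : w != w0 -> S w != finset.set0.
  by move=> /SE; rewrite -card_gt0 => ->.
have X_gt0 : (0 < #|X|)%N by rewrite cardX muln_gt0 expn_gt0 mu2_gt0.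
have hit (Y : {set X}) : (#|X| <= #|Y|.*2)%N ->
    exists2 a, a != w0 & S a \subset Y.
  move=> /hitS[[w ww] wY]; exists w => //; rewrite /S insubT //.
rewrite -cardN; exists (hidden_class S); split.
- by rewrite card_hidden_class // -expnM /n -mulnA mulnn.
- have [th [K [sth cth Kmu sinK]]] := grover_angle R (ltn0Sn m).
  exists (K + mu)%N; first by lia.
  apply: (quantum_hidden_class X_gt0 cth sinK _ S0) => a.
  have [->|aw] := eqVneq a w0; [by left|right]; rewrite SE //; split=> //.
  have mu0 : mu%:R != 0 :> R by rewrite pnatr_eq0.
  rewrite sth cardX natrM !natrX -/mu; move: (mu%:R) mu0 => M M0.
  by field.
move=> q /(det_hidden_class S0 Sn0 hit); rewrite card_ord.
by lia.
Qed.

Lemma leq_class_size (mu : nat) :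
  (0 < mu)%N -> (4 * mu ^ 5 * 2 ^ (8 * mu) <= 2 ^ (15 * mu))%N.
Proof.
move=> mu_gt0; have mu2 : (mu ^ 5 <= 2 ^ (5 * mu))%N.
  by rewrite mulnC expnM leq_exp2r // ltnW // ltn_expl.
have mu4 : (4 <= 2 ^ (2 * mu))%N by rewrite (@leq_exp2l 2 2) // leq_pmulr.
rewrite (_ : 15 * mu = 2 * mu + 5 * mu + 8 * mu)%N; last by lia.
rewrite 2!expnD; exact: leq_mul (leq_mul mu4 mu2) (leqnn _).
Qed.

Lemma log2_le (R : realType) (N e : nat) :
  (0 < N)%N -> (N <= 2 ^ e)%N -> log2 (N%:R : R) <= e%:R.
Proof.
move=> N_gt0 Ne; have ln2 : 0 < ln 2 :> R by rewrite ln_gt0 ?ltr1n.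
rewrite /log2 ler_pdivrMr // mulrC mulr_natr -lnXn ?ltr0n // -natrX.
by rewrite ler_ln ?posrE ?ltr0n ?expn_gt0 ?ler_nat.
Qed.

Theorem theorem1p4 (R : realType) :
  exists kappa : R, 0 < kappa /\
  exists (N : nat -> nat) (C : forall k : nat, {set concept (N k)}),
    [/\ forall k, (0 < N k)%N,
        (fun k => quantumQ R (C k)) @ \oo --> \oo
      & forall k,
          kappa * (quantumQ R (C k))%:R ^+ 3 * log2 (N k)%:R
            <= (detQ (C k))%:R :> R].
Proof.
pose N k := (4 * k.+1 ^ 5 * 2 ^ (8 * k.+1))%N.
pose C k : {set concept (N k)} := sval (cid (hidden_class_params R k)).
have CP k := svalP (cid (hidden_class_params R k)); rewrite -/(C _) in CP.
have N_gt0 k : (0 < N k)%N by rewrite !muln_gt0 !expn_gt0.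
have N_le k : (N k <= 2 ^ (15 * k.+1))%N by exact: leq_class_size.
(* [405 = 3 ^ 3 * 15], from [Q <= 3 * k.+1] and [log2 N <= 15 * k.+1]. *)
exists (405%:R^-1); split; first by rewrite invr_gt0 ltr0n.
exists N, C; split=> // [|k].
  (* The rank bound reads [8 * k.+1 ^ 2 <= 32 * k.+1 * q], hence [k.+1 <= 4 * q]. *)
  apply/cvgnyPge => B; exists (4 * B)%N => // k /= Bk.
  have [[A AP] _] := quantumQ_min R (C k) (N_gt0 k).
  have [cardC _ _] := CP k.
  have := card_quantum_learnable AP; set q := quantumQ R (C k).
  rewrite cardC => le1.
  have le2 : ((N k).+1 <= 2 ^ (16 * k.+1))%N.
    rewrite (leq_ltn_trans (N_le k)) // ltn_exp2l //; lia.
  have : (2 ^ (8 * k.+1 ^ 2) <= 2 ^ (16 * k.+1 * q.*2))%N.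
    apply: leq_trans le1 _; rewrite expnM.
    by case: (q.*2) => // e; rewrite leq_exp2r.
  rewrite leq_exp2l // -mulnn; nia.
have [_ [q q_le qC] Dge] := CP k.
have [_ /(_ _ qC) Qq] := quantumQ_min R (C k) (N_gt0 k).
have [DC _] := detQ_min (C k).
have {}Dge := Dge _ DC.
have logN := log2_le R (N_gt0 k) (N_le k).
set Q := quantumQ R (C k) in Qq *; set D := detQ (C k) in DC Dge *.
have Q3 : Q%:R ^+ 3 <= (3 * k.+1%:R) ^+ 3 :> R.
  by rewrite -natrM ler_pXn2r ?nnegrE ?ler0n // ler_nat (leq_trans Qq).
apply: (@le_trans _ _ (405%:R^-1 * (3 * k.+1%:R) ^+ 3 * (15 * k.+1)%:R)).
  rewrite -[leLHS]mulrA -[leRHS]mulrA ler_wpM2l ?invr_ge0 ?ler0n //.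
  apply: (@le_trans _ _ (Q%:R ^+ 3 * (15 * k.+1)%:R)).
    by rewrite ler_wpM2l // exprn_ge0 ?ler0n.
  by rewrite ler_wpM2r ?ler0n.
apply: (@le_trans _ _ (2 * k.+1%:R ^+ 4)); last by rewrite -natrX -natrM ler_nat.
rewrite natrM.
have -> : 405%:R^-1 * (3 * k.+1%:R) ^+ 3 * (15%:R * k.+1%:R) = k.+1%:R ^+ 4 :> R.
  by field.
by have : 0 <= k.+1%:R ^+ 4 :> R by []; lra.
Qed.
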